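(* Let $G=(V,E)$ be a finite simple undirected graph and let $\succeq$ be the preorder on $V$ defined in the context. For all $i,j\in V$: $i\succeq j$ if and only if there exists an injective function $f:\mathcal{N}(j)\to\mathcal{N}(i)$ such that $f(k)\succeq k$ for all $k\in\mathcal{N}(j)$.
   Context: $\mathbb{N}=\{1,2,3,\ldots\}$; $a\sim b$ means that $a,b\in V$ are neighbors in $G$; $\mathcal{N}(a)$ is the set of neighbors of $a$; $d(a)$ is the degree of $a$. For $\ell\in\mathbb{N}$ and $i\in V$, the set of paths (walks) of length $\ell$ departing from $i$ is $$\mathcal{P}_\ell(i)=\{(i_0,i_1,\ldots,i_\ell)\in V^{\ell+1} : i_0=i,\ i_k\sim i_{k+1}\ \text{for } 0\le k\le \ell-1\}.$$ For $0\le m\le \ell$, $\pi_{\le m}(x_0,x_1,\ldots,x_\ell)=(x_0,\ldots,x_m)$. For a vector of nodes $\mathbf{p}$, $\mathbf{d}(\mathbf{p})$ is the vector of the degrees of its entries; inequalities between vectors are componentwise. For $i,j\in V$ and $\ell\in\mathbb{N}$, a function $f^\ell_{ji}:\mathcal{P}_\ell(j)\to\mathcal{P}_\ell(i)$ is called $\ell$-adapted at $(j,i)$ if for all $\mathbf{p},\widetilde{\mathbf{p}}\in\mathcal{P}_\ell(j)$ and all $m\le\ell$: $\pi_{\le m}(\mathbf{p})=\pi_{\le m}(\widetilde{\mathbf{p}})$ implies $\pi_{\le m}(f^\ell_{ji}(\mathbf{p}))=\pi_{\le m}(f^\ell_{ji}(\widetilde{\mathbf{p}}))$, and $\pi_{\le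 m}(\mathbf{p})\ne\pi_{\le m}(\widetilde{\mathbf{p}})$ implies $\pi_{\le m}(f^\ell_{ji}(\mathbf{p}))\ne\pi_{\le m}(f^\ell_{ji}(\widetilde{\mathbf{p}}))$. An adapted sequence at $(j,i)$ is a sequence $(f^\ell_{ji})_{\ell\in\mathbb{N}}$ of $\ell$-adapted functions $f^\ell_{ji}:\mathcal{P}_\ell(j)\to\mathcal{P}_\ell(i)$ such that for every $\ell\in\mathbb{N}$, $f^{\ell+1}_{ji}$ extends $f^\ell_{ji}$, i.e. for all $\mathbf{p}\in\mathcal{P}_\ell(j)$ and $\mathbf{q}\in\mathcal{P}_{\ell+1}(j)$: if $\mathbf{p}=\pi_{\le\ell}(\mathbf{q})$ then $\pi_{\le\ell}(f^{\ell+1}_{ji}(\mathbf{q}))=f^\ell_{ji}(\mathbf{p})$, and if $\mathbf{p}\ne\pi_{\le\ell}(\mathbf{q})$ then $\pi_{\le\ell}(f^{\ell+1}_{ji}(\mathbf{q}))\ne f^\ell_{ji}(\mathbf{p})$. Definition of $\succeq$: $i\succeq j$ if there exists an adapted sequence $(f^\ell_{ji})_{\ell\in\mathbb{N}}$ at $(j,i)$ such that for all $\ell\in\mathbb{N}$, $f^\ell_{ji}$ is injective and $\mathbf{d}(f^\ell_{ji}(\mathbf{p}))\ge\mathbf{d}(\mathbf{p})$ for all $\mathbf{p}\in\mathcal{P}_\ell(j)$. *)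

(* Defs.v *)
From mathcomp Require Import all_boot.

Set Implicit Arguments.
Unset Strict Implicit.
Unset Printing Implicit Defensive.

Section Domination.

(* A finite simple graph on V is given by its adjacency relation e; the
   symmetry and irreflexivity of e are hypotheses of the theorem. *)
Variables (V : finType) (e : rel V).

Definition nbhd (a : V) : {set V} := [set b | e a b].

Definition deg (a : V) : nat := #|nbhd a|.

Definition nbr (a : V) : Type := {b : V | b \in nbhd a}.

(* A walk of length l has l + 1 vertices. *)
Definition walk (l : nat) (i : V) : Type :=
  {p : l.+1.-tuple V | (thead p == i) && sorted e p}.

(* The first m + 1 entries (x_0, ..., x_m). *)
Definition pi_le (m : nat) (p : seq V) : seq V := take m.+1 p.

Definition degv (l : nat) (p : l.+1.-tuple V) : l.+1.-tuple nat :=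
  map_tuple deg p.

Definition vec_le (n : nat) (u v : n.-tuple nat) : Prop :=
  forall k : 'I_n, tnth u k <= tnth v k.

Definition adapted (l : nat) (j i : V) (f : walk l j -> walk l i) : Prop :=
  forall (p p' : walk l j) (m : nat), m <= l ->
    (pi_le m (val p) = pi_le m (val p') ->
     pi_le m (val (f p)) = pi_le m (val (f p')))
    /\ (pi_le m (val p) <> pi_le m (val p') ->
        pi_le m (val (f p)) <> pi_le m (val (f p'))).

Definition extends (l : nat) (j i : V)
    (g : walk l.+1 j -> walk l.+1 i) (f : walk l j -> walk l i) : Prop :=
  forall (p : walk l j) (q : walk l.+1 j),
    (tval (val p) = pi_le l (val q) ->
     pi_le l (val (g q)) = tval (val (f p)))
    /\ (tval (val p) <> pi_le l (val q) ->
        pi_le l (val (g q)) <> tval (val (f p))).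

(* Lengths range over {1, 2, 3, ...}: the term of index l of a sequence acts
   on walks of length l + 1. *)
Definition adapted_sequence (j i : V)
    (f : forall l : nat, walk l.+1 j -> walk l.+1 i) : Prop :=
  (forall l : nat, adapted (f l)) /\
  (forall l : nat, extends (f l.+1) (f l)).

(* dominates i j is the relation "i succeeds or equals j"; the maps go from
   walks departing from j to walks departing from i. *)
Definition dominates (i j : V) : Prop :=
  exists f : forall l : nat, walk l.+1 j -> walk l.+1 i,
    adapted_sequence f /\
    forall l : nat,
      injective (f l) /\
      forall p : walk l.+1 j, vec_le (degv (val p)) (degv (val (f l p))).

End Domination.

(* Main.v *)
Require Import Defs.
From mathcomp Require Import all_boot.

(** The walks departing from a vertex [j] form a rooted tree under the prefix
    order: the root is the walk of length 0, and the children of a walk are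
    its one-step prolongations.  The maps in the definition of [dominates]
    glue to a single map of the tree at [j] into the tree at [i] that keeps
    length and prefixes and is injective ([dominatesP]).  The degree
    inequalities come for free: an injective map of trees sends the children
    of a walk injectively to the children of its image, and the number of
    children is the degree of the end vertex ([embedding_deg_last]).

    The theorem is then the recursive structure of trees.  Below the root of
    the tree at [j] hang the trees at the neighbours of [j], so an embedding
    of the tree at [j] into the tree at [i] restricts, on walks of length 1,
    to an injection [f] of the neighbours, and below each neighbour [k] to an
    embedding of the tree at [k] into the tree at [f k]
    ([embedding_branch]).  Conversely, such an injection and such embeddings
    of the branches are grafted into an embedding of the whole tree
    ([embedding_graft]). *)

Set Implicit Arguments.
Unset Strict Implicit.
Unset Printing Implicit Defensive.

Section WalkTrees.

Variables (V : finType) (e : rel V).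

(** A walk is represented by the list of its vertices after the starting
    point; the starting point is a parameter.  Thus the root of the tree at
    [j] is the empty list, and no length occurs in a type. *)
Record walk_embedding (j i : V) (F : seq V -> seq V) : Prop := WalkEmbedding {
  embedding_path : forall s, path e j s -> path e i (F s);
  embedding_size : forall s, path e j s -> size (F s) = size s;
  embedding_take : forall s m, path e j s -> F (take m s) = take m (F s);
  embedding_inj : forall s t, path e j s -> path e j t -> F s = F t -> s = t
}.

(** * Walks as lists *)

Lemma walk_eqE l j (w : walk e l j) :
  tval (val w) = j :: behead (tval (val w)).
Proof.
case: w => -[[|x s] sz] //= /andP[/eqP + _].
by rewrite /thead (tnth_nth x) /= => ->.
Qed.

Lemma walk_path l j (w : walk e l j) : path e j (behead (tval (val w))).
Proof. by have /andP[_] := valP w; rewrite [tval _]walk_eqE. Qed.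

Lemma size_behead_walk l j (w : walk e l j) : size (behead (tval (val w))) = l.
Proof. by rewrite size_behead size_tuple. Qed.

Lemma walk_inj l j (w w' : walk e l j) :
  behead (tval (val w)) = behead (tval (val w')) -> w = w'.
Proof.
move=> eq_ww'; apply/val_inj/val_inj.
by rewrite /= [tval (val w)]walk_eqE [tval (val w')]walk_eqE eq_ww'.
Qed.

Lemma is_walk j s :
  path e j s -> (thead (in_tuple (j :: s)) == j) && sorted e (in_tuple (j :: s)).
Proof. by move=> js; rewrite /thead (tnth_nth j) /= eqxx. Qed.

Definition walk_of_path j s (js : path e j s) : walk e (size s) j :=
  exist _ (in_tuple (j :: s)) (is_walk js).

Lemma walk_of_list l j s : size s = l -> path e j s ->
  exists w : walk e l j, behead (tval (val w)) = s.
Proof. by move=> <- js; exists (walk_of_path js). Qed.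

(** * Degrees under an embedding *)

(** The degree of the end vertex counts the children of a walk, and an
    embedding maps the children of [s] injectively to the children of
    [F s]. *)
Lemma embedding_deg_last j i F s : walk_embedding j i F -> path e j s ->
  deg e (last j s) <= deg e (last i (F s)).
Proof.
move=> embF js.
have child x : x \in nbhd e (last j s) -> path e j (rcons s x).
  by rewrite inE rcons_path js => ->.
have childE x : x \in nbhd e (last j s) ->
    F (rcons s x) = rcons (F s) (last i (F (rcons s x))).
  move=> /child jsx; have := embedding_size embF jsx.
  have := embedding_take embF (size s) jsx; rewrite -cats1 take_size_cat //.
  rewrite cats1 size_rcons; case/lastP: (F (rcons s x)) => // t y.
  rewrite size_rcons last_rcons => Fs [st].
  by rewrite Fs -st -{2}cats1 take_size_cat.
rewrite /deg -(@card_in_imset _ _ (fun x => last i (F (rcons s x)))).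
  apply/subset_leq_card/subsetP => _ /imsetP[x sx ->]; rewrite inE.
  have := embedding_path embF (child x sx).
  by rewrite [F _]childE // rcons_path last_rcons => /andP[].
move=> x y sx sy eq_xy; suff /rcons_inj[] : rcons s x = rcons s y by [].
apply: (embedding_inj embF (child x sx) (child y sy)).
by rewrite childE // eq_xy -childE.
Qed.

(** * Domination as an embedding of walk trees *)

Section Glue.

Variables (j i : V) (f : forall l, walk e l.+1 j -> walk e l.+1 i).
Hypotheses (ext_f : forall l, extends (@f l.+1) (@f l))
           (inj_f : forall l, injective (@f l)).

(** The root is treated apart since the maps [f] start at length 1; a list
    that is not a walk from [j] gets the junk value [[::]]. *)
Definition glue (s : seq V) : seq V :=
  if s is x :: t then
    oapp (fun w : walk e (size t).+1 j => behead (tval (val (f w)))) [::]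
      (insub (in_tuple (j :: x :: t)))
  else [::].

(** Lengths and walks enter the definition of [glue] only through this
    equation: the walk rebuilt from the list is the original one, its length
    being the size of the list. *)
Lemma glue_walk l (w : walk e l.+1 j) :
  glue (behead (tval (val w))) = behead (tval (val (f w))).
Proof.
have := walk_path w; have := size_behead_walk w; have := @walk_inj _ _ w.
case: (behead _) => // x t inj_w [tl]; case: _ / tl in w inj_w * => jxt.
rewrite (inj_w (walk_of_path jxt)) //.
by rewrite /glue [insub _](valK (walk_of_path jxt)).
Qed.

Lemma glue_path s : path e j s -> path e i (glue s).
Proof.
case: s => // x t /(walk_of_list (erefl _)) [w <-].
by rewrite glue_walk walk_path.
Qed.

Lemma size_glue s : path e j s -> size (glue s) = size s.
Proof.
case: s => // x t /(walk_of_list (erefl _)) [w <-].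
by rewrite glue_walk !size_behead_walk.
Qed.

(** This is the meaning of [extends]: removing the last vertex of a walk
    removes the last vertex of its image. *)
Lemma glue_rcons s x :
  path e j (rcons s x) -> glue s = take (size s) (glue (rcons s x)).
Proof.
case: s => [|y s] jsx; first by rewrite take0.
have js : path e j (y :: s) by move: jsx; rewrite rcons_path => /andP[].
have [w wE] := walk_of_list (s := y :: s) (erefl (size s).+1) js.
have [//|w' w'E] := walk_of_list (l := (size s).+2) _ jsx.
  by rewrite size_rcons.
rewrite -[rcons _ x]w'E -{1}wE !glue_walk.
have w_w' : tval (val w) = pi_le (size s).+1 (tval (val w')).
  rewrite [LHS]walk_eqE [tval (val w')]walk_eqE wE w'E /pi_le.
  by rewrite -cats1 /= take_size_cat.
have /proj1/(_ w_w') := ext_f w w'.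
by rewrite [tval (val (f w'))]walk_eqE => <-.
Qed.

Lemma glue_take s m : path e j s -> glue (take m s) = take m (glue s).
Proof.
elim/last_ind: s => // s x IHs jsx; have := jsx.
rewrite rcons_path => /andP[/IHs {}IHs _].
case: (ltnP (size s) m) => [lt_sm | le_ms].
  by rewrite !take_oversize ?size_glue ?size_rcons.
by rewrite -cats1 takel_cat // IHs cats1 (glue_rcons jsx) take_takel.
Qed.

(** Equal images have equal lengths, hence so do the walks, and injectivity
    of a single map [f] applies. *)
Lemma glue_inj s t : path e j s -> path e j t -> glue s = glue t -> s = t.
Proof.
move=> js jt eq_st; have eq_sz : size s = size t.
  by rewrite -(size_glue js) -(size_glue jt) eq_st.
case: s js eq_sz eq_st => [_ /esym/size0nil //|x s js eq_sz].
have [w <-] := walk_of_list (erefl _) js.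
have [w' <-] := walk_of_list (esym eq_sz) jt.
by rewrite !glue_walk => /walk_inj/inj_f ->.
Qed.

Lemma glue_embedding : walk_embedding j i glue.
Proof.
split; [exact: glue_path | exact: size_glue | | exact: glue_inj].
by move=> s m; apply: glue_take.
Qed.

End Glue.

Section Unglue.

Variables (j i : V) (F : seq V -> seq V).
Hypothesis embF : walk_embedding j i F.

Lemma embedding_walk l (w : walk e l j) :
  exists w' : walk e l i, tval (val w') = i :: F (behead (tval (val w))).
Proof.
have jw := walk_path w.
have szFw : size (F (behead (tval (val w)))) = l.
  by rewrite (embedding_size embF jw) size_behead_walk.
have [w' w'E] := walk_of_list szFw (embedding_path embF jw).
by exists w'; rewrite walk_eqE w'E.
Qed.

(** Since [F] commutes with truncation and is injective, it both preserves
    and reflects equality of prefixes, which is all that [adapted] and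
    [extends] ask.  The [k]-th vertex of a walk is the end of its truncation
    at [k], so the componentwise degree inequality is that for end
    vertices. *)
Lemma embedding_dominates : dominates e i j.
Proof.
(* Walks of a given length form a finite type, so [xchoose] produces the whole
   sequence of maps without an axiom of choice. *)
have ex l (w : walk e l j) : exists w' : walk e l i,
    tval (val w') == i :: F (behead (tval (val w))).
  by have [w' /eqP] := embedding_walk w; exists w'.
pose f l (w : walk e l.+1 j) : walk e l.+1 i := xchoose (ex _ w).
have fE l (w : walk e l.+1 j) : tval (val (@f l w)) = i :: F (behead (tval (val w))).
  exact/eqP/(xchooseP (ex _ w)).
have pi_leE l (w : walk e l j) m :
    pi_le m (tval (val w)) = j :: take m (behead (tval (val w))).
  by rewrite [tval (val w)]walk_eqE.
have path_take l (w : walk e l j) m : path e j (take m (behead (tval (val w)))).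
  exact/take_path/walk_path.
have pi_le_f l (w : walk e l.+1 j) m :
    pi_le m (tval (val (@f l w))) = i :: F (take m (behead (tval (val w)))).
  by rewrite fE /pi_le /= (embedding_take embF m (walk_path w)).
exists f; split; first split.
- move=> l p p' m _; rewrite !pi_leE !pi_le_f; split=> [[->] // | neq_pp'].
  by case=> /(embedding_inj embF (path_take _ _ _) (path_take _ _ _)) eq_pp';
    rewrite eq_pp' in neq_pp'.
- move=> l p q; rewrite pi_le_f fE pi_leE [tval (val p)]walk_eqE /=.
  split=> [[->] // | neq_pq].
  case=> /(embedding_inj embF (path_take _ _ _) (walk_path _)) eq_pq.
  by rewrite eq_pq in neq_pq.
- move=> l; split=> [w w' eq_f | w k].
    apply/walk_inj/(embedding_inj embF (walk_path _) (walk_path _)).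
    by have := fE l w; rewrite eq_f fE => -[].
  have sz_w : k <= size (behead (tval (val w))).
    by rewrite size_behead_walk -ltnS.
  have nth_take_last a s n : n <= size s -> nth a (a :: s) n = last a (take n s).
    case: n => [|n] lt_ns; first by rewrite take0.
    by rewrite -nth_last size_takel // nth_take.
  rewrite !tnth_map (tnth_nth j) (tnth_nth i) fE [tval (val w)]walk_eqE.
  rewrite !nth_take_last ?(embedding_size embF (walk_path w)) //.
  rewrite -(embedding_take embF _ (walk_path w)).
  exact: embedding_deg_last embF (path_take _ _ _).
Qed.

End Unglue.

Lemma dominatesP j i : dominates e i j <-> exists F, walk_embedding j i F.
Proof.
split=> [[f [[_ ext_f] emb_f]] | [F]]; last exact: embedding_dominates.
by exists (glue f); apply: glue_embedding => // l; have [] := emb_f l.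
Qed.

(** * Branches and grafting *)

(** All walks that begin with the step to [k] have images that begin with the
    step to [k'], because [F] keeps prefixes; removing this common first step
    is therefore injective on the images. *)
Lemma embedding_branch j i F k k' : walk_embedding j i F -> e j k ->
  F [:: k] = [:: k'] -> walk_embedding k k' (fun s => behead (F (k :: s))).
Proof.
move=> embF jk Fk.
have jks s : path e k s -> path e j (k :: s) by rewrite /= jk.
have FE s : path e k s -> F (k :: s) = k' :: behead (F (k :: s)).
  move/jks=> ks; have := embedding_take embF 1 ks; rewrite /= take0 Fk.
  by case: (F _) => //= x t; rewrite take0 => -[->].
split=> [s ks | s ks | s m ks | s t ks kt eq_st].
- by have := embedding_path embF (jks s ks); rewrite FE //= => /andP[].
- by rewrite size_behead (embedding_size embF (jks s ks)).
- by have := embedding_take embF m.+1 (jks s ks); rewrite /= => ->; rewrite FE.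
- suff [] : k :: s = k :: t by [].
  by apply: (embedding_inj embF); rewrite ?jks // FE // eq_st -FE.
Qed.

(** Walks with different first steps have images with different first steps
    as [f] is injective; walks with the same first step [k] are separated by
    [G k]. *)
Lemma embedding_graft j i (f : nbr e j -> nbr e i) G : injective f ->
  (forall k, walk_embedding (val k) (val (f k)) (G k)) ->
  exists F, walk_embedding j i F.
Proof.
move=> inj_f embG.
pose F s := if s is x :: t then
    oapp (fun k => val (f k) :: G k t) [::] (insub x : option (nbr e j))
  else [::].
have FE (k : nbr e j) t : F (val k :: t) = val (f k) :: G k t by rewrite /F valK.
have path_cons s x : path e j (x :: s) -> exists2 k : nbr e j,
    x = val k & path e (val k) s.
  by case/andP=> jx xs; have jx' : x \in nbhd e j; [rewrite inE | exists (Sub x jx')].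
exists F; split=> [[|x s] // | [|x s] // | [|x s] [|m] // | [|x s] [|y t] //].
- case/path_cons=> k -> ks; rewrite FE /= (embedding_path (embG k)) // andbT.
  by have := valP (f k); rewrite inE.
- by case/path_cons=> k -> ks; rewrite FE /= (embedding_size (embG k)).
- by rewrite !take0.
- by case/path_cons=> k -> ks; rewrite [take _ _]/= !FE (embedding_take (embG k)).
- by move=> _ /path_cons[k -> ks]; rewrite FE.
- by case/path_cons=> k -> ks _; rewrite FE.
case/path_cons=> k -> ks /path_cons[l -> lt]; rewrite !FE.
case=> /val_inj/inj_f eq_kl; rewrite -eq_kl in lt *.
by move/(embedding_inj (embG k) ks lt) => ->.
Qed.

End WalkTrees.

Theorem theorem17 (V : finType) (e : rel V)
    (e_sym : symmetric e) (e_irr : irreflexive e) (i j : V) :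
  dominates e i j <->
  exists f : nbr e j -> nbr e i,
    injective f /\ forall k : nbr e j, dominates e (val (f k)) (val k).
Proof.
split=> [/dominatesP[F embF] | [f [inj_f dom_f]]]; last first.
  have /fin_all_exists[G embG] (k : nbr e j) :
      exists G, walk_embedding e (val k) (val (f k)) G.
    exact/dominatesP.
  exact/dominatesP/(embedding_graft inj_f embG).
have path1 (k : nbr e j) : path e j [:: val k].
  by have := valP k; rewrite inE /= => ->.
have /fin_all_exists[f Ff] (k : nbr e j) :
    exists k' : nbr e i, F [:: val k] = [:: val k'].
  have := embedding_path embF (path1 k); have := embedding_size embF (path1 k).
  case: (F _) => [|x []] // _ /=; rewrite andbT => ix.
  have ix' : x \in nbhd e i by rewrite inE.
  by exists (Sub x ix').
exists f; split=> [k l eq_f | k].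
  apply: val_inj; suff [] : [:: val k] = [:: val l] by [].
  by apply: (embedding_inj embF (path1 k) (path1 l)); rewrite !Ff eq_f.
apply/dominatesP; exists (fun s => behead (F (val k :: s))).
apply: embedding_branch embF _ (Ff k).
by have := path1 k; rewrite /= andbT.
Qed.
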